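(* Let $p=p(n)\in[0,1)$ be such that $p\to1$ and $1-p=n^{o(1)}$ as $n\to\infty$. Then, with high probability, $$\chi(\mathbf G(n,p))=(1+o(1))\frac{n\log\frac{1}{1-p}}{2\log(pn)}.$$
   Context: $\mathbf G(n,p)$ is the binomial random graph on vertex set $[n]$ in which each pair of distinct vertices is an edge independently with probability $p$. $\chi$ is the chromatic number; $\log$ is the natural logarithm. ''With high probability'' means with probability tending to $1$ as $n\to\infty$; $X=(1+o(1))Y$ whp means for every fixed $\epsilon>0$, $(1-\epsilon)Y\le X\le(1+\epsilon)Y$ with probability tending to $1$. *)

(* Defs.v *)
From HB Require Import structures.
From mathcomp Require Import all_boot all_order all_algebra.
From mathcomp Require Import all_classical all_reals all_analysis.
Set Implicit Arguments.
Unset Strict Implicit.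
Unset Printing Implicit Defensive.
Import Order.TTheory GRing.Theory Num.Theory.
Import numFieldNormedType.Exports.
Local Open Scope ring_scope.

Definition vpairs (T : finType) : {set {set T}} := [set e : {set T} | #|e| == 2%N].

(* A simple graph on T is given by its edge set, a subset of [vpairs T]. *)
Definition simple_graph (T : finType) : {set {set {set T}}} :=
  powerset (vpairs T).

Definition graph_adj (T : finType) (E : {set {set T}}) : rel T :=
  fun u v => (u != v) && ([set u; v] \in E).

Definition colorable (T : finType) (E : {set {set T}}) (k : nat) : bool :=
  [exists f : {ffun T -> 'I_k},
     [forall u, forall v, graph_adj E u v ==> (f u != f v)]].

Lemma ex_colorable (T : finType) (E : {set {set T}}) :
  exists k, colorable E k.
Proof.
exists #|T|; apply/existsP; exists [ffun u => enum_rank u].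
apply/forallP => u; apply/forallP => v; apply/implyP => /andP[neq_uv _].
by rewrite !ffunE (inj_eq enum_rank_inj).
Qed.

Definition chromatic_number (T : finType) (E : {set {set T}}) : nat :=
  ex_minn (ex_colorable E).

(* The law of G(n, p): the product over all pairs of Bernoulli(p) laws. *)
Definition gnp_weight (R : realType) (n : nat) (p : R)
    (E : {set {set 'I_n}}) : R :=
  \prod_(e in vpairs 'I_n) (if e \in E then p else 1 - p).

Definition gnp_prob (R : realType) (n : nat) (p : R)
    (A : pred {set {set 'I_n}}) : R :=
  \sum_(E in simple_graph 'I_n | A E) gnp_weight p E.

Definition gnp_whp (R : realType) (p : nat -> R)
    (A : forall n, pred {set {set 'I_n}}) : Prop :=
  (gnp_prob (p n) (A n) @[n --> \oo] --> (1 : R))%classic.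

(* [x n = n^{o(1)}]; stated eventually, since [n%:R `^ e n] is 0 or 1 for n < 2
   and the relation only concerns n going to infinity. *)
Definition is_n_pow_o1 (R : realType) (x : nat -> R) : Prop :=
  exists2 e : nat -> R, (e n @[n --> \oo] --> (0 : R))%classic &
    (\forall n \near \oo, x n = n%:R `^ e n)%classic.

(* Main.v *)
(** Write q = 1 - p = n^(-d), so that d tends to 0 and d log n to infinity; the
    predicted value is then asymptotic to n d / 2.  The lower bound is the first
    moment method: there is no independent set with slightly more than 2 / d
    vertices.

    For the upper bound we follow Bollobas: with high probability every set W of
    n^(1 - o(1)) vertices contains an independent k-set, where k is slightly less
    than 2 / d, so colour classes of size k can be removed greedily until few
    vertices are left.  To beat the 2^n choices of W, let Y be the largest number
    of independent k-subsets of W that pairwise share at most one vertex.  Adding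
    or deleting an edge changes Y by at most 1, so Y has subgaussian tails with
    variance proxy O(n^2), while Turan's theorem and a second moment computation
    give E Y >= n^(7/4).  Hence Y = 0 has probability at most
    exp(- n^(3/2) / 8). *)

Require Import Defs.
From HB Require Import structures.
From mathcomp Require Import all_boot all_order all_algebra.
From mathcomp Require Import all_classical all_reals all_analysis.
From mathcomp Require Import zify ring lra fintype finset.
Set Implicit Arguments.
Unset Strict Implicit.
Unset Printing Implicit Defensive.
Import Order.TTheory GRing.Theory Num.Theory.
Import numFieldNormedType.Exports.
Local Open Scope ring_scope.

(** * Product Bernoulli measures on subsets of a finite set, and exponential moments *)

Section ProductBernoulli.
Variables (R : realType) (I : finType) (p : R).
Implicit Types (A B E : {set I}) (f g : {set I} -> R).

(** The ground set [A] is a parameter, so that statements about the mean can be proved by induction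
    on [A], one coordinate at a time; [G(n, p)] is the case where [A] consists of all pairs. *)
Definition bernoulli_weight A E : R :=
  \prod_(e in A) (if e \in E then p else 1 - p).

Definition bernoulli_mean A f : R :=
  \sum_(E in powerset A) bernoulli_weight A E * f E.

Lemma bernoulli_mean0 f : bernoulli_mean set0 f = f set0.
Proof.
rewrite /bernoulli_mean powerset0 big_set1 /bernoulli_weight big_set0.
by rewrite mul1r.
Qed.

(** Conditioning on the coordinate [a]: outcomes that contain [a] correspond to subsets of [A]
    through insertion and removal of [a]. *)
Lemma bernoulli_meanU1 a A f : a \notin A ->
  bernoulli_mean (a |: A) f =
  p * bernoulli_mean A (fun E => f (a |: E)) + (1 - p) * bernoulli_mean A f.
Proof.
move=> aA; rewrite /bernoulli_mean (bigID (fun E : {set I} => a \in E)) /=.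
congr (_ + _).
  rewrite (reindex_onto (fun E => a |: E) (fun E => E :\ a)) /=; last first.
    by move=> E /andP[_ aE]; rewrite setD1K.
  rewrite mulr_sumr; apply: eq_big => [E|E].
    rewrite !powersetE setU11 andbT; apply/andP/idP => [[EA /eqP <-]|EA].
      apply/subsetP => x; rewrite !inE => /andP[xa /predU1P[xE|xE]].
        by rewrite xE eqxx in xa.
      have := subsetP EA x; rewrite !inE xE orbT (negbTE xa) /=.
      exact.
    split; first exact: setUS.
    by rewrite setU1K //; apply: contra aA; apply: (subsetP EA).
  rewrite !powersetE => /andP[/andP[EA _] _].
  rewrite /bernoulli_weight big_setU1 //= setU11 !mulrA; congr (_ * _ * _).
  apply: eq_bigr => e eA; rewrite in_setU1; case: eqP => // ea.
  by rewrite -ea eA in aA.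
rewrite mulr_sumr; apply: eq_big => [E|E].
  rewrite !powersetE; apply/andP/idP => [[EA aE]|EA].
    apply/subsetP => x xE; have := subsetP EA x xE.
    by rewrite !inE => /predU1P[xa|//]; rewrite -xa xE in aE.
  split; first exact: subset_trans EA (subsetUr _ _).
  by apply: contra aA; apply: (subsetP EA).
rewrite !powersetE => /andP[_ aE].
by rewrite /bernoulli_weight big_setU1 //= (negbTE aE) mulrA.
Qed.

Lemma eq_bernoulli_mean A f g :
  (forall E, f E = g E) -> bernoulli_mean A f = bernoulli_mean A g.
Proof. by move=> fg; apply: eq_bigr => E _; rewrite fg. Qed.

Lemma bernoulli_meanD A f g :
  bernoulli_mean A (fun E => f E + g E) =
  bernoulli_mean A f + bernoulli_mean A g.
Proof. by rewrite -big_split; apply: eq_bigr => E _; rewrite mulrDr. Qed.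

Lemma bernoulli_meanZ A (c : R) f :
  bernoulli_mean A (fun E => c * f E) = c * bernoulli_mean A f.
Proof. by rewrite mulr_sumr; apply: eq_bigr => E _; rewrite mulrCA. Qed.

Lemma bernoulli_mean_sum (J : finType) (P : pred J) A (F : J -> {set I} -> R) :
  bernoulli_mean A (fun E => \sum_(j | P j) F j E) =
  \sum_(j | P j) bernoulli_mean A (F j).
Proof.
by rewrite exchange_big; apply: eq_bigr => E _; rewrite mulr_sumr.
Qed.

Lemma set_ind (P : {set I} -> Prop) :
  P set0 -> (forall a A, a \notin A -> P A -> P (a |: A)) -> forall A, P A.
Proof.
move=> P0 PU A; elim: {A}_.+1 {-2}A (ltnSn #|A|) => // n IHn A.
have [->//|[a aA]] := set_0Vmem A.
rewrite ltnS (cardsD1 a) aA add1n => An; rewrite -(setD1K aA).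
by apply: PU (IHn _ An); rewrite !inE eqxx.
Qed.

Lemma bernoulli_mean_disjoint A B :
  bernoulli_mean A (fun E => [disjoint E & B]%:R) = (1 - p) ^+ #|A :&: B|.
Proof.
elim/set_ind: A => [|a A aA IH].
  by rewrite bernoulli_mean0 set0I cards0 disjoints_subset
     sub0set.
rewrite bernoulli_meanU1 // setIUl; case: (boolP (a \in B)) => aB.
  rewrite (_ : bernoulli_mean A _ = 0); last first.
    by apply: big1 => E _; rewrite disjoints_subset subUset sub1set in_setC aB mulr0.
  rewrite mulr0 add0r IH -exprS; congr (_ ^+ _).
  rewrite (_ : [set a] :&: B = [set a]); last first.
    by apply/setIidPl; rewrite sub1set.
  by rewrite cardsU1 !inE (negbTE aA).
rewrite (_ : [set a] :&: B = set0); last first.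
  by apply/setP => x; rewrite !inE; case: eqP => // ->; rewrite (negbTE aB).
rewrite set0U -IH [X in p * X](_ : _ = bernoulli_mean A
  (fun E => [disjoint E & B]%:R)); first by ring.
by apply: eq_bernoulli_mean => E; rewrite !disjoints_subset subUset sub1set
   in_setC aB.
Qed.

Lemma bernoulli_mean_cst A (c : R) : bernoulli_mean A (fun=> c) = c.
Proof.
elim/set_ind: A => [|a A aA IH]; first by rewrite bernoulli_mean0.
by rewrite bernoulli_meanU1 // IH; ring.
Qed.

Hypothesis p01 : 0 <= p <= 1.

Lemma ler_bernoulli_mean A f g :
  (forall E, E \subset A -> f E <= g E) ->
  bernoulli_mean A f <= bernoulli_mean A g.
Proof.
move=> fg; apply: ler_sum => E; rewrite powersetE => EA.
apply: ler_wpM2l (fg _ EA); apply: prodr_ge0 => e _.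
by case/andP: p01 => p0 p1; case: ifP => //; rewrite subr_ge0.
Qed.

(** From [1 - x <= expR (- x)] one gets [expR x * (1 - x) <= 1], while the right side times [1 - x]
    equals [1 + x^2 (1 - 2 x)], which is at least 1. *)
Lemma expR_le_quad (x : R) : x <= 1 / 2 -> expR x <= 1 + x + 2 * x ^+ 2.
Proof.
move=> x2; have x1 : 0 < 1 - x by lra.
have := expR_ge1Dx (- x); rewrite expRN => H.
have e0 := expR_gt0 x.
have : expR x * (1 - x) <= expR x * (expR x)^-1 by rewrite ler_pM2l.
rewrite mulfV ?gt_eqF //.
move=> H2; rewrite -(ler_pM2r x1); apply: le_trans H2 _; nra.
Qed.

(** A form of Hoeffding's lemma with a crude constant: both values lie within 1 of their mean [m],
    and after factoring out [expR (l * m)] the linear terms of the quadratic bound cancel. *)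
Lemma two_point_mgf (l u v : R) : `|l| <= 1 / 2 -> `|u - v| <= 1 ->
  p * expR (l * u) + (1 - p) * expR (l * v) <=
  expR (l * (p * u + (1 - p) * v) + 2 * l ^+ 2).
Proof.
move=> l2 uv; case/andP: p01 => p0 p1.
set m := p * u + (1 - p) * v.
have small (w : R) : `|w| <= 1 -> l * w <= 1 / 2.
  move=> w1; apply: le_trans (ler_norm _) _; rewrite normrM.
  by rewrite -[1 / 2]mulr1; apply: ler_pM.
have um : `|u - m| <= 1.
  rewrite (_ : u - m = (1 - p) * (u - v)); last by rewrite /m; ring.
  rewrite normrM ger0_norm ?subr_ge0 // -[leRHS]mulr1; apply: ler_pM => //; lra.
have vm : `|v - m| <= 1.
  rewrite (_ : v - m = - (p * (u - v))); last by rewrite /m; ring.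
  rewrite normrN normrM ger0_norm // -[leRHS]mulr1; apply: ler_pM => //.
have Hu := expR_le_quad (small _ um).
have Hv := expR_le_quad (small _ vm).
have -> : l * u = l * m + l * (u - m) by ring.
have -> : l * v = l * m + l * (v - m) by ring.
rewrite !expRD !(mulrCA _ (expR (l * m))) -mulrDr.
apply: ler_wpM2l; first exact: expR_ge0.
apply: le_trans (expR_ge1Dx _).
have sq (w : R) : `|w| <= 1 -> (l * w) ^+ 2 <= l ^+ 2.
  move=> w1; rewrite exprMn -[leRHS]mulr1; apply: ler_wpM2l; first exact: sqr_ge0.
  by rewrite -real_normK ?num_real // expr_le1.
have Su := sq _ um; have Sv := sq _ vm.
apply: (@le_trans _ _ (p * (1 + l * (u - m) + 2 * l ^+ 2) +
   (1 - p) * (1 + l * (v - m) + 2 * l ^+ 2))).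
  by apply: lerD; apply: ler_wpM2l; lra.
by rewrite le_eqVlt; apply/orP; left; apply/eqP; rewrite /m; ring.
Qed.

(** The bounded differences inequality, by induction on [A] instead of a martingale. The two
    conditional means given one coordinate differ by at most 1, so [two_point_mgf] applies to them
    and each coordinate costs [2 * l ^+ 2] in the exponent. *)
Lemma bernoulli_mgf A f (l : R) : `|l| <= 1 / 2 ->
  (forall a E, a \in A -> `|f (a |: E) - f E| <= 1) ->
  bernoulli_mean A (fun E => expR (l * f E)) <=
  expR (l * bernoulli_mean A f + 2 * l ^+ 2 * #|A|%:R).
Proof.
move=> l2; elim/set_ind: A f => [|a A aA IH] f lip.
  by rewrite !bernoulli_mean0 cards0 mulr0 addr0.
rewrite !bernoulli_meanU1 // cardsU1 aA natrD.
set f1 := fun E => f (a |: E).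
have lip0 b E : b \in A -> `|f (b |: E) - f E| <= 1.
  by move=> bA; apply: lip; rewrite in_setU1 bA orbT.
have lip1 b E : b \in A -> `|f1 (b |: E) - f1 E| <= 1.
  by move=> bA; rewrite /f1 setUCA; apply: lip0.
have I0 := IH _ lip0; have I1 := IH _ lip1.
case/andP: p01 => p0 p1.
have mean_lip : `|bernoulli_mean A f1 - bernoulli_mean A f| <= 1.
  have la E : `|f1 E - f E| <= 1 by apply: lip; rewrite setU11.
  have c1 := bernoulli_mean_cst A 1.
  have L1 : bernoulli_mean A f1 <= 1 + bernoulli_mean A f.
    rewrite -{1}c1 -bernoulli_meanD; apply: ler_bernoulli_mean => E _.
    by have := la E; rewrite ler_norml => /andP[]; lra.
  have L2 : bernoulli_mean A f <= 1 + bernoulli_mean A f1.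
    rewrite -{1}c1 -bernoulli_meanD; apply: ler_bernoulli_mean => E _.
    by have := la E; rewrite ler_norml => /andP[]; lra.
  by rewrite ler_norml; apply/andP; split; lra.
have T := two_point_mgf l2 mean_lip.
set v := 2 * l ^+ 2 * #|A|%:R in I0 I1 *.
apply: (@le_trans _ _ (p * expR (l * bernoulli_mean A f1 + v) +
  (1 - p) * expR (l * bernoulli_mean A f + v))).
  by apply: lerD; apply: ler_wpM2l => //; lra.
rewrite (_ : 2 * l ^+ 2 * (1%:R + #|A|%:R) = 2 * l ^+ 2 + v); last first.
  by rewrite /v; ring.
rewrite addrA !(expRD _ v) !(mulrA _ _ (expR v)) -mulrDl.
by apply: ler_wpM2r T; exact: expR_ge0.
Qed.

End ProductBernoulli.

(** * Binomial estimates and a Turan bound for independent sets *)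

Lemma leq_bin_expn (k j : nat) : ('C(k, j) <= k ^ j)%N.
Proof.
apply: (@leq_trans (k ^_ j)); first by rewrite -bin_ffact leq_pmulr ?fact_gt0.
elim: j => // j IHj; rewrite ffactnSr expnSr leq_mul //; lia.
Qed.

(** The quotient of the two binomials is the product of [(k - i) / (w - i)] over [i < j], and each
    factor is at most [k / w]. *)
Lemma leq_bin_sub (w k j : nat) : (j <= k)%N -> (k <= w)%N ->
  ('C(w - j, k - j) * w ^ j <= 'C(w, k) * k ^ j)%N.
Proof.
move=> + kw; elim: j => [|j IHj jk]; first by rewrite !subn0 !muln1.
have := mul_bin_diag (w - j) (k - j.+1).
rewrite (_ : (k - j.+1).+1 = k - j)%N; last by lia.
rewrite (_ : (w - j).-1 = w - j.+1)%N; last by lia.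
set x := 'C(_, _); set y := 'C(_, _) => H.
have {}IHj := IHj (ltnW jk); rewrite -/y in IHj.
have xy : (x * w <= y * k)%N.
  have a : ((k - j) * w <= (w - j) * k)%N by nia.
  have wj : (0 < w - j)%N by lia.
  rewrite -(leq_pmul2l wj) mulnA H mulnAC (mulnC y) mulnA.
  by rewrite leq_mul2r a orbT.
rewrite !expnS mulnA; apply: leq_trans (leq_mul xy (leqnn _)) _.
by rewrite -mulnA (mulnCA 'C(w, k)) mulnCA leq_mul2l IHj orbT.
Qed.

(* Caro-Wei by greedily deleting the closed neighbourhood of a vertex of
   minimal degree d: the quadratic bound drops by 2cd - c^2 d^2 <= 1. *)
Lemma turan_independent (R : realType) (J : finType) (e : rel J) (c : R)
    (X : {set J}) :
  symmetric e -> {in X, forall s, e s s} ->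
  exists F : {set J}, [/\ F \subset X,
    {in F &, forall s t, s != t -> ~~ e s t} &
    2 * c * #|X|%:R - c ^+ 2 * \sum_(s in X) \sum_(t in X) (e s t)%:R
      <= #|F|%:R].
Proof.
move=> esym; elim: {X}_.+1 {-2}X (ltnSn #|X|) => // n IHn X Xn erefl.
have [X0|[v0 v0X]] := set_0Vmem X.
  exists set0; split; [exact: sub0set|by move=> s t; rewrite inE|].
  by rewrite X0 big_set0 !cards0 !mulr0 subr0.
pose deg s := #|[set t in X | e s t]|.
have [v vX vmin] := @arg_minnP _ v0 (fun x => x \in X) deg v0X.
pose N := [set t in X | e v t].
have vN : v \in N by rewrite inE vX erefl.
have NX : N \subset X by apply/subsetP => t; rewrite inE => /andP[].
have [F [FX Find Fcard]] : exists F : {set J}, [/\ F \subset X :\: N,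
    {in F &, forall s t, s != t -> ~~ e s t} &
    2 * c * #|X :\: N|%:R -
      c ^+ 2 * \sum_(s in X :\: N) \sum_(t in X :\: N) (e s t)%:R
      <= #|F|%:R].
  apply: IHn => [|s]; last by rewrite inE => /andP[_ /erefl].
  rewrite cardsDS //; have := subset_leq_card NX.
  have : (0 < #|N|)%N by rewrite card_gt0; apply/set0Pn; exists v.
  move: Xn; lia.
have vF t : t \in F -> ~~ e v t.
  by move=> /(subsetP FX); rewrite !inE negb_and => /andP[/orP[/negP|//]].
exists (v |: F); split.
- rewrite subUset sub1set vX; apply: subset_trans FX _; exact: subsetDl.
- move=> s t /setU1P[->|sF] /setU1P[->|tF] st; last exact: Find.
  + by rewrite eqxx in st.
  + exact: vF.
  + by rewrite esym; apply: vF.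
have vnF : v \notin F by apply/negP => /vF; rewrite erefl.
rewrite cardsU1 vnF add1n -natr1.
have -> : #|X|%:R = #|N|%:R + #|X :\: N|%:R :> R.
  by rewrite cardsDS // -natrD subnKC // subset_leq_card.
(* By minimality of [deg v], each of the [#|N|] rows indexed by [N] contributes at least [#|N|] to
   the double sum. *)
have Dge : #|N|%:R ^+ 2 +
    \sum_(s in X :\: N) \sum_(t in X :\: N) (e s t)%:R <=
    \sum_(s in X) \sum_(t in X) (e s t)%:R :> R.
  rewrite [leRHS](big_setID N) /= (setIidPr NX); apply: lerD; last first.
    apply: ler_sum => s _; rewrite [leRHS](big_setID N) /= (setIidPr NX).
    by rewrite lerDr; apply: sumr_ge0 => t _; exact: ler0n.
  rewrite expr2 -[#|N|%:R in leLHS]/(#|N|%:R) mulr_natl -sumr_const.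
  apply: ler_sum => s sN; rewrite -natr_sum ler_nat.
  apply: leq_trans (vmin s _) _; first exact: (subsetP NX).
  rewrite /deg -sum1dep_card big_mkcondr /=.
  by apply: leq_sum => t _; case: (e s t).
set D := \sum_(s in X) _ in Dge *; set D' := \sum_(s in X :\: N) _ in Dge Fcard.
have c2 := sqr_ge0 c.
have H1 : c ^+ 2 * (#|N|%:R ^+ 2 + D') <= c ^+ 2 * D by exact: ler_wpM2l.
have H2 := sqr_ge0 (1 - c * #|N|%:R).
lra.
Qed.

(** * Packings of independent k-sets: Lipschitz property, mean and lower tail *)

Section Packing.
Variable T : finType.
Implicit Types (E F : {set {set T}}) (S W : {set T}) (k : nat).

Definition pairs_in S : {set {set T}} := [set e : {set T} | e \subset S & #|e| == 2%N].

(** Phrased as disjointness of edge sets so that [bernoulli_mean_disjoint] gives the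
    probabilities. *)
Definition independent E S : bool := [disjoint E & pairs_in S].

Definition ksubsets W k : {set {set T}} := [set S : {set T} | S \subset W & #|S| == k].

Definition indep_ksubsets E W k : {set {set T}} :=
  [set S in ksubsets W k | independent E S].

(** Equivalently, no pair of vertices lies in two distinct members, so a single edge can spoil at
    most one member. *)
Definition packing F : bool :=
  [forall S in F, forall S' in F, (S != S') ==> (#|S :&: S'| < 2)%N].

Definition packing_number E W k : nat :=
  \max_(F : {set {set T}} | (F \subset indep_ksubsets E W k) && packing F) #|F|.

Lemma packing_sub F F' : F' \subset F -> packing F -> packing F'.
Proof.
move=> /subsetP F'F /forall_inP pF; apply/forall_inP => S /F'F SF.
by apply/forall_inP => S' /F'F S'F; apply: (forall_inP (pF _ SF)).
Qed.

Lemma independentU1 a E S :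
  independent (a |: E) S = (a \notin pairs_in S) && independent E S.
Proof. by rewrite /independent !disjoints_subset subUset sub1set in_setC. Qed.

(** Adding the edge [a] creates no independent set and destroys only those containing [a]. A packing
    has at most one such member, and discarding it leaves a packing for [a |: E]. *)
Lemma packing_number_lipschitz a E W k : a \in vpairs T ->
  (packing_number (a |: E) W k <= packing_number E W k
    <= (packing_number (a |: E) W k).+1)%N.
Proof.
rewrite inE => /eqP a2; apply/andP; split.
  apply/bigmax_leqP => F /andP[FI pF]; apply: (leq_bigmax_cond F).
  rewrite pF andbT; apply: subset_trans FI _; apply/subsetP => S.
  by rewrite !inE independentU1 => /andP[-> /andP[_ ->]].
apply/bigmax_leqP => F /andP[FI pF].
pose F' := [set S : {set T} in F | ~~ (a \subset S)].
have F'F : F' \subset F by apply/subsetP => S; rewrite inE => /andP[].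
have F'le : (#|F'| <= packing_number (a |: E) W k)%N.
  apply: (leq_bigmax_cond F'); rewrite (packing_sub F'F pF) andbT.
  apply/subsetP => S; rewrite inE => /andP[/(subsetP FI)].
  rewrite [in X in X -> _]inE [in X in _ -> _ -> X]inE => /andP[-> iS] aS.
  by rewrite independentU1 iS inE negb_and aS.
apply: leq_trans (_ : #|F'| + 1 <= _)%N; last by rewrite addn1 ltnS.
rewrite -(cardsID [set S : {set T} | a \subset S] F) addnC leq_add //.
  by apply: subset_leq_card; apply/subsetP => S; rewrite !inE andbC.
apply: contraT; rewrite -ltnNge => /card_gt1P[S [S' [+ + SS']]].
rewrite !inE => /andP[SF aS] /andP[S'F aS'].
have := forall_inP (forall_inP pF _ SF) _ S'F; rewrite SS' /= -a2 ltnNge.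
by rewrite subset_leq_card // subsetI aS aS'.
Qed.

Lemma packing_number_eq0 E W k :
  indep_ksubsets E W k = set0 -> packing_number E W k = 0%N.
Proof.
move=> I0; apply/eqP; rewrite -leqn0; apply/bigmax_leqP => F /andP[].
by rewrite I0 subset0 => /eqP ->; rewrite cards0.
Qed.

(** This is [turan_independent] for the relation of sharing at least two vertices on the independent
    k-sets; [1 < k] makes this relation reflexive there, so the double sum includes the diagonal. *)
Lemma packing_number_ge (R : realType) (c : R) E W k : (1 < k)%N ->
  2 * c * (\sum_(S in ksubsets W k) (independent E S)%:R) -
  c ^+ 2 * (\sum_(S in ksubsets W k) \sum_(S' in ksubsets W k)
      ((1 < #|S :&: S'|)%N && (independent E S && independent E S'))%:R)
  <= (packing_number E W k)%:R.
Proof.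
move=> k1; pose e := [rel S S' : {set T} | (1 < #|S :&: S'|)%N].
have esym : symmetric e by move=> S S'; rewrite /= setIC.
have erefl : {in indep_ksubsets E W k, forall S, e S S}.
  by move=> S; rewrite !inE /= setIid => /andP[/andP[_ /eqP ->]].
have [F [FI Fe Fc]] := turan_independent c esym erefl.
apply: le_trans (_ : #|F|%:R <= _); last first.
  rewrite ler_nat; apply: (leq_bigmax_cond F); rewrite FI /=.
  apply/forall_inP => S SF; apply/forall_inP => S' S'F; apply/implyP => SS'.
  by have := Fe _ _ SF S'F SS'; rewrite /= -leqNgt.
apply: le_trans Fc; rewrite le_eqVlt; apply/orP; left; apply/eqP.
congr (_ * _ - _ * _).
  rewrite -sum1_card natr_sum big_mkcond [RHS]big_mkcond /=.
  apply: eq_bigr => S _; rewrite [in RHS]inE.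
  by case: (S \in _) => //=; case: independent.
rewrite [RHS](eq_bigl (fun S => (S \in ksubsets W k) && independent E S)); last first.
  by move=> S; rewrite inE.
rewrite [RHS]big_mkcondr; apply: eq_bigr => S _; case iS: independent; last first.
  by apply: big1 => S' _; rewrite andbF.
rewrite [RHS](eq_bigl (fun S => (S \in ksubsets W k) && independent E S)); last first.
  by move=> S'; rewrite inE.
rewrite [RHS]big_mkcondr; apply: eq_bigr => S' _; rewrite /=.
by case: independent; rewrite ?andbF ?andbT.
Qed.

Lemma card_pairs_in S : #|pairs_in S| = 'C(#|S|, 2).
Proof. exact: cards_draws. Qed.

Lemma pairs_in_sub S : pairs_in S \subset vpairs T.
Proof. by apply/subsetP => e; rewrite !inE => /andP[]. Qed.

Lemma pairs_inI S S' : pairs_in S :&: pairs_in S' = pairs_in (S :&: S').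
Proof.
by apply/setP => e; rewrite !inE subsetI; case: (_ == 2%N); rewrite ?andbT ?andbF.
Qed.

Lemma card_pairs_inU S S' : #|pairs_in S :|: pairs_in S'| =
  ('C(#|S|, 2) + 'C(#|S'|, 2) - 'C(#|S :&: S'|, 2))%N.
Proof. by rewrite cardsU pairs_inI !card_pairs_in. Qed.

Lemma mean_independent (R : realType) (p : R) S :
  bernoulli_mean p (vpairs T) (fun E => (independent E S)%:R) =
  (1 - p) ^+ 'C(#|S|, 2).
Proof.
by rewrite bernoulli_mean_disjoint (setIidPr (pairs_in_sub S)) card_pairs_in.
Qed.

Lemma mean_independent2 (R : realType) (p : R) S S' :
  bernoulli_mean p (vpairs T)
    (fun E => (independent E S && independent E S')%:R) =
  (1 - p) ^+ ('C(#|S|, 2) + 'C(#|S'|, 2) - 'C(#|S :&: S'|, 2)).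
Proof.
have VU : vpairs T :&: (pairs_in S :|: pairs_in S') = pairs_in S :|: pairs_in S'.
  by apply/setIidPr; rewrite subUset !pairs_in_sub.
rewrite -card_pairs_inU -VU -bernoulli_mean_disjoint.
apply: eq_bernoulli_mean => E.
by rewrite /independent !disjoints_subset setCU subsetI.
Qed.

(** Such an [S'] is determined by its trace on [S], a j-subset of [S], and by [S' :\: S], a subset
    of [W :\: S] of size [k - j]. *)
Lemma card_ksubsets_meet S W k j : S \in ksubsets W k ->
  (#|[set S' : {set T} in ksubsets W k | #|S :&: S'| == j]| <=
    'C(k, j) * 'C(#|W| - k, k - j))%N.
Proof.
rewrite inE => /andP[SW /eqP Sk].
pose h S' := (S :&: S', S' :\: S).
have hinj : injective h.
  move=> A B [AB1 AB2]; rewrite -(setID A S) -(setID B S) AB2.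
  by rewrite setIC AB1 setIC.
rewrite -(card_imset _ hinj) -Sk -cardsDS //.
rewrite -!cards_draws -cardsX; apply: subset_leq_card.
apply/subsetP => _ /imsetP[S' + ->].
rewrite !inE /= subsetIl => /andP[/andP[S'W /eqP S'k] /eqP <-].
by rewrite eqxx setSD //= -S'k -(cardsID S S') setIC addKn.
Qed.

(* [packing_number_ge] is used with the optimal [c], the inverse of [mu * s],
   where [mu] is the mean number of independent k-subsets; the j-th term of the
   sum bounds, relatively to [mu ^+ 2], the pairs meeting in j vertices. *)
Lemma mean_packing_number (R : realType) (p s : R) W k :
  0 <= p < 1 -> 0 < s -> (1 < k)%N -> (k <= #|W|)%N ->
  \sum_(2 <= j < k.+1)
     ((k%:R ^+ 2 / #|W|%:R) ^+ j / (1 - p) ^+ 'C(j, 2)) <= s ->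
  s^-1 <= bernoulli_mean p (vpairs T) (fun E => (packing_number E W k)%:R).
Proof.
move=> /andP[p0 p1] s0 k1 kW sums.
set q := 1 - p in sums *; have q0 : 0 < q by rewrite subr_gt0.
have p01 : 0 <= p <= 1 by rewrite p0 ltW.
have W0 : 0 < #|W|%:R :> R by rewrite ltr0n (leq_trans _ kW) // ltnW.
pose mu : R := 'C(#|W|, k)%:R * q ^+ 'C(k, 2).
have mu0 : 0 < mu.
  by rewrite mulr_gt0 ?exprn_gt0 // ltr0n bin_gt0.
pose c := (mu * s)^-1.
pose X E : R := \sum_(S in ksubsets W k) (independent E S)%:R.
pose D E : R := \sum_(S in ksubsets W k) \sum_(S' in ksubsets W k)
      ((1 < #|S :&: S'|)%N && (independent E S && independent E S'))%:R.
have cardK : #|ksubsets W k| = 'C(#|W|, k) by exact: cards_draws.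
have meanX : bernoulli_mean p (vpairs T) X = mu.
  rewrite bernoulli_mean_sum (eq_bigr (fun=> q ^+ 'C(k, 2))).
    by rewrite sumr_const cardK /mu mulr_natl.
  by move=> S; rewrite inE mean_independent => /andP[_ /eqP ->].
have meanD : bernoulli_mean p (vpairs T) D <= mu ^+ 2 * s.
  rewrite bernoulli_mean_sum.
  apply: le_trans (_ : \sum_(S in ksubsets W k)
     'C(#|W|, k)%:R * q ^+ ('C(k, 2) * 2) * s <= _); last first.
    rewrite sumr_const cardK -mulr_natl /mu exprMn exprM expr2.
    by rewrite le_eqVlt; apply/orP; left; apply/eqP; ring.
  apply: ler_sum => S SK; rewrite bernoulli_mean_sum.
  have Sk : #|S| = k by move: SK; rewrite inE => /andP[_ /eqP].
  have meet_lt S' : (#|S :&: S'| < k.+1)%N.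
    by rewrite ltnS -Sk subset_leq_card // subsetIl.
  (* [g j] is the probability that two k-sets meeting in [j] vertices are both independent, set to 0
     when they share no pair. *)
  pose g j : R := if (1 < j)%N then q ^+ ('C(k, 2) * 2 - 'C(j, 2)) else 0.
  rewrite (eq_bigr (fun S' : {set T} => g #|S :&: S'|)); last first.
    move=> S'; rewrite inE => /andP[_ /eqP S'k]; rewrite /g.
    case: ifP => _ /=; last by rewrite bernoulli_mean_cst.
    by rewrite mean_independent2 Sk S'k -/q muln2 addnn.
  (* Group the sets [S'] by the size of their intersection with [S]; it is at most [k], so [inord]
     preserves it. *)
  rewrite (partition_big (fun S' : {set T} => inord #|S :&: S'| : 'I_k.+1)
     predT) //=.
  apply: le_trans (_ : \sum_(j < k.+1)
    ('C(k, j) * 'C(#|W| - k, k - j))%:R * g j <= _).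
    apply: ler_sum => j _.
    rewrite (eq_bigr (fun=> g j)); last first.
      move=> S' /andP[_ /eqP <-]; by rewrite inordK.
    rewrite sumr_const -[g j *+ _]mulr_natl; apply: ler_wpM2r.
      by rewrite /g; case: ifP => // _; rewrite exprn_ge0 // ltW.
    rewrite ler_nat; apply: leq_trans (card_ksubsets_meet j SK).
    apply: subset_leq_card; apply/subsetP => S'.
    rewrite [in X in _ -> X]inE => /andP[-> /eqP <-] /=; by rewrite inordK.
  rewrite -(big_mkord predT (fun j => ('C(k, j) * 'C(#|W| - k, k - j))%:R * g j)).
  rewrite (big_cat_nat (n := 2)) //=; last by rewrite ltnW // ltnS.
  rewrite [X in X + _]big1_seq ?add0r; last first.
    move=> j /andP[_]; rewrite mem_index_iota /g => /andP[_].
    by rewrite ltnS leqNgt => /negbTE ->; rewrite mulr0.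
  apply: le_trans (ler_wpM2l _ sums); last first.
    by rewrite mulr_ge0 // exprn_ge0 // ltW.
  rewrite mulr_sumr big_nat_cond [leRHS]big_nat_cond.
  apply: ler_sum => j; rewrite andbT ltnS => /andP[j2 jk]; rewrite /g j2.
  (* The subtraction in the exponent does not truncate, so it can be turned into a division. *)
  have bjk : ('C(j, 2) <= 'C(k, 2) * 2)%N.
    by apply: leq_trans (leq_bin2l 2 jk) _; rewrite leq_pmulr.
  rewrite expfB_cond ?gt_eqF //.
  rewrite mulrACA.
  apply: ler_wpM2r; first by rewrite divr_ge0 // exprn_ge0 // ltW.
  rewrite expr_div_n mulrA ler_pdivlMr ?exprn_gt0 //.
  rewrite -!natrX -!natrM ler_nat.
  (* One factor [k ^ j] comes from ['C(k, j)] and another from [leq_bin_sub], whence the [k ^+ 2] in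
     the summand. *)
  have H1 := leq_bin_sub jk kW; have H2 := leq_bin_expn k j.
  have H3 : ('C(#|W| - k, k - j) <= 'C(#|W| - j, k - j))%N.
    by apply: leq_bin2l; lia.
  apply: leq_trans (leq_mul (leq_mul H2 H3) (leqnn _)) _.
  by rewrite -mulnA expnAC -mulnn [leqRHS]mulnCA leq_mul2l H1 orbT.
have -> : s^-1 = 2 * c * mu - c ^+ 2 * (mu ^+ 2 * s).
  by rewrite /c; field; rewrite !gt_eqF.
apply: le_trans (_ : 2 * c * mu - c ^+ 2 * bernoulli_mean p (vpairs T) D <= _).
  by rewrite lerD2l lerN2 ler_wpM2l // sqr_ge0.
rewrite -meanX -bernoulli_meanZ -mulNr -bernoulli_meanZ -bernoulli_meanD.
apply: ler_bernoulli_mean => // E _; rewrite mulNr; exact: packing_number_ge.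
Qed.

(** Chernoff's method for the lower tail: the indicator is at most [expR (- l * Y)] with [Y] the
    packing number, since [Y] vanishes on the event, and [bernoulli_mgf] bounds the mean of this
    exponential. *)
Lemma prob_no_indep_ksubset (R : realType) (p s l : R) W k :
  0 <= p < 1 -> 0 < s -> (1 < k)%N -> (k <= #|W|)%N ->
  0 <= l <= 1 / 2 ->
  \sum_(2 <= j < k.+1)
     ((k%:R ^+ 2 / #|W|%:R) ^+ j / (1 - p) ^+ 'C(j, 2)) <= s ->
  bernoulli_mean p (vpairs T) (fun E => (indep_ksubsets E W k == set0)%:R) <=
  expR (- (l / s) + 2 * l ^+ 2 * 'C(#|T|, 2)%:R).
Proof.
move=> p01 s0 k1 kW /andP[l0 l2] sums.
have meanY := mean_packing_number p01 s0 k1 kW sums.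
have p01' : 0 <= p <= 1 by case/andP: p01 => -> /ltW.
have lN : `|- l| <= 1 / 2 by rewrite normrN ger0_norm.
have lip a E : a \in vpairs T ->
    `|(packing_number (a |: E) W k)%:R - (packing_number E W k)%:R| <= 1 :> R.
  move=> /(packing_number_lipschitz E W k) /andP[].
  rewrite -!(ler_nat R) -natr1 ler_norml => ? ?; lra.
apply: (@le_trans _ _ (bernoulli_mean p (vpairs T)
   (fun E => expR (- l * (packing_number E W k)%:R)))).
  apply: ler_bernoulli_mean => // E _; case: eqP => [I0|_]; last exact: expR_ge0.
  by rewrite packing_number_eq0 // mulr0 expR0.
apply: le_trans (bernoulli_mgf p01' lN lip) _.
rewrite ler_expR; apply: lerD; first by rewrite mulNr lerN2 ler_wpM2l.
by rewrite sqrrN (_ : vpairs T = pairs_in setT) ?card_pairs_in ?cardsT //;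
   apply/setP => e; rewrite !inE subsetT.
Qed.

End Packing.

(** * Deterministic bounds on the chromatic number from independent sets *)

Lemma independent_adj (T : finType) (E : {set {set T}}) (S : {set T}) u v :
  independent E S -> u \in S -> v \in S -> ~~ graph_adj E u v.
Proof.
move=> iS uS vS; apply/negP => /andP[uv uvE].
have := disjointFr iS uvE.
by rewrite inE cards2 uv eqxx andbT subUset !sub1set uS vS.
Qed.

(** Greedy colouring: while at least [m] vertices remain, an independent k-set is removed as a
    colour class; afterwards every remaining vertex gets its own colour. Multiplying by [k] avoids
    division. *)
Lemma chromatic_number_le (T : finType) (E : {set {set T}}) (m k : nat) :
  (forall W : {set T}, (m <= #|W|)%N -> indep_ksubsets E W k != set0) ->
  (chromatic_number E * k <= m * k + #|T|)%N.
Proof.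
move=> hasI.
have part (W : {set T}) : exists t (f : T -> nat), [/\ (t * k <= m * k + #|W|)%N,
    forall u, u \in W -> (f u < t)%N &
    forall u v, u \in W -> v \in W -> graph_adj E u v -> f u <> f v].
  elim: {W}_.+1 {-2}W (ltnSn #|W|) => // b IHb W Wb.
  (* The case [k = 0] is set aside because removing an empty class would not shrink [W]; the bound
     is then trivial. *)
  case: (boolP ((#|W| < m)%N || (k == 0)%N)) => [Wm|].
    exists #|W|, (fun u => index u (enum W)); split.
    - apply: leq_trans (leq_addr _ _); rewrite leq_mul2r.
      by case/orP: Wm => [/ltnW ->|->]; rewrite ?orbT.
    - by move=> u uW; rewrite cardE index_mem mem_enum.
    - move=> u v uW vW /andP[/eqP uv _] /(f_equal (nth u (enum W))).
      by rewrite !nth_index ?mem_enum.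
  rewrite negb_or -leqNgt => /andP[Wm kn0].
  have /set0Pn[S] := hasI _ Wm.
  rewrite !inE => /andP[/andP[SW /eqP Sk] iS].
  have WS : #|W :\: S| = (#|W| - k)%N by rewrite cardsDS // Sk.
  have kW : (k <= #|W|)%N by rewrite -Sk subset_leq_card.
  have [t [f [tk ft fE]]] : exists t (f : T -> nat),
     [/\ (t * k <= m * k + #|W :\: S|)%N,
    forall u, u \in W :\: S -> (f u < t)%N &
    forall u v, u \in W :\: S -> v \in W :\: S -> graph_adj E u v ->
      f u <> f v].
    by apply: IHb; rewrite WS; lia.
  exists t.+1, (fun u => if u \in S then t else f u); split.
  - by rewrite mulSn; move: tk; rewrite WS; lia.
  - move=> u uW; case: ifPn => // uS; rewrite ltnS ltnW // ft //.
    by rewrite inE uS.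
  - move=> u v uW vW uv; case: ifPn => uS; case: ifPn => vS.
    + by rewrite (negbTE (independent_adj iS uS vS)) in uv.
    + by move=> tE; have := ft v; rewrite -tE ltnn inE vS vW => /(_ isT).
    + by move=> tE; have := ft u; rewrite tE ltnn inE uS uW => /(_ isT).
    + by apply: fE uv; rewrite inE ?uS ?vS.
have [t [f [tk ft fE]]] := part setT.
rewrite cardsT in tk; apply: leq_trans tk; rewrite leq_mul2r; apply/orP; right.
rewrite /chromatic_number; case: ex_minnP => c _; apply.
have ltf u : (f u < t)%N by apply: ft; rewrite inE.
apply/existsP; exists [ffun u => Ordinal (ltf u)].
apply/forallP => u; apply/forallP => v; apply/implyP => uv.
by rewrite !ffunE -val_eqE /=; apply/eqP/fE; rewrite ?inE.
Qed.

(** Colour classes are independent, so each has at most [s] vertices: a larger one would contain an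
    independent set of size [s.+1]. *)
Lemma chromatic_number_ge (T : finType) (E : {set {set T}}) (s : nat) :
  indep_ksubsets E setT s.+1 = set0 -> (#|T| <= chromatic_number E * s)%N.
Proof.
move=> I0; rewrite /chromatic_number; case: ex_minnP => c /existsP[f fE] _.
rewrite -sum1_card (partition_big f predT) //=.
apply: leq_trans (_ : \sum_(i < c) s <= _)%N; last by rewrite sum_nat_const card_ord.
apply: leq_sum => i _; rewrite sum1dep_card leqNgt; apply/negP.
set A := [set x | _] => sA.
have /set0Pn[S] : ksubsets A s.+1 != set0.
  by rewrite -card_gt0 /ksubsets cards_draws bin_gt0.
rewrite inE => /andP[SA sS].
suff : S \in indep_ksubsets E setT s.+1 by rewrite I0 inE.
rewrite !inE subsetT sS /=; apply/pred0P => e /=; apply/negbTE/negP.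
rewrite !inE => /andP[eE /andP[eS /cards2P[u [v [uv euv]]]]].
have uS : u \in A by apply/(subsetP SA)/(subsetP eS); rewrite euv !inE eqxx.
have vS : v \in A.
  by apply/(subsetP SA)/(subsetP eS); rewrite euv !inE eqxx orbT.
move: uS vS; rewrite !inE => /eqP fu /eqP fv.
have := forallP (forallP fE u) v.
by rewrite /graph_adj uv -euv eE fu fv eqxx.
Qed.

(** * First moment and union bounds in the random graph *)

Section GnpUnionBound.
Variables (R : realType) (n : nat) (p : R).
Hypothesis p01 : 0 <= p < 1.
Implicit Types (A B : pred {set {set 'I_n}}).

Lemma gnp_probE A :
  gnp_prob p A = bernoulli_mean p (vpairs 'I_n) (fun E => (A E)%:R).
Proof.
rewrite /gnp_prob big_mkcondr; apply: eq_bigr => E _.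
by case: (A E); rewrite ?mulr1 ?mulr0.
Qed.

Let p01' : 0 <= p <= 1. Proof. by case/andP: p01 => -> /ltW. Qed.

Lemma gnp_prob_le1 A : gnp_prob p A <= 1.
Proof.
rewrite gnp_probE -[leRHS](bernoulli_mean_cst p (vpairs 'I_n) 1).
by apply: ler_bernoulli_mean => // E _; rewrite lern1 leq_b1.
Qed.

Lemma gnp_prob_sub A B : (forall E, A E -> B E) -> gnp_prob p A <= gnp_prob p B.
Proof.
move=> AB; rewrite !gnp_probE; apply: ler_bernoulli_mean => // E _.
by rewrite ler_nat; have := AB E; case: (A E) => // ->.
Qed.

(** The failure indicator is at most [X + Z], where [X] counts independent sets of size [s.+1] and
    [Z] counts the sets [W] of size at least [m] without an independent k-subset. The factor
    [2 ^+ n] bounds the number of sets [W]. *)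
Lemma gnp_chromatic_bounds (m k s : nat) (x : R) : 0 <= x ->
  (forall W : {set 'I_n}, (m <= #|W|)%N ->
    bernoulli_mean p (vpairs 'I_n)
      (fun E => (indep_ksubsets E W k == set0)%:R) <= x) ->
  1 - ('C(n, s.+1)%:R * (1 - p) ^+ 'C(s.+1, 2) + 2 ^+ n * x) <=
  gnp_prob p (fun E : {set {set 'I_n}} => (n <= chromatic_number E * s)%N &&
                       (chromatic_number E * k <= m * k + n)%N).
Proof.
move=> x0 Wx; rewrite gnp_probE lerBlDr.
pose X (E : {set {set 'I_n}}) : R := \sum_(S in ksubsets setT s.+1) (independent E S)%:R.
pose Z E : R := \sum_(W : {set 'I_n} | (m <= #|W|)%N)
  (indep_ksubsets E W k == set0)%:R.
have meanX : bernoulli_mean p (vpairs 'I_n) X =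
    'C(n, s.+1)%:R * (1 - p) ^+ 'C(s.+1, 2).
  rewrite bernoulli_mean_sum (eq_bigr (fun=> (1 - p) ^+ 'C(s.+1, 2))).
    by rewrite sumr_const cards_draws cardsT card_ord mulr_natl.
  by move=> S; rewrite inE mean_independent => /andP[_ /eqP ->].
have meanZ : bernoulli_mean p (vpairs 'I_n) Z <= 2 ^+ n * x.
  rewrite bernoulli_mean_sum; apply: le_trans (ler_sum _ _) _ => [W|].
    exact: Wx.
  rewrite sumr_const -[x *+ _]mulr_natl -natrX; apply: ler_wpM2r => //.
  rewrite ler_nat; apply: leq_trans (max_card _) _.
  by rewrite -cardsT -powersetT card_powerset cardsT card_ord.
rewrite -meanX.
apply: le_trans (lerD (lexx _) (lerD (lexx _) meanZ)).
rewrite -!bernoulli_meanD -[leLHS](bernoulli_mean_cst p (vpairs 'I_n) 1).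
apply: ler_bernoulli_mean => // E _.
have X0 : 0 <= X E by apply: sumr_ge0.
have Z0 : 0 <= Z E by apply: sumr_ge0.
case: (boolP (indep_ksubsets E setT s.+1 == set0)) => [/eqP Is|]; last first.
  move=> /set0Pn[S]; rewrite inE => /andP[SK iS].
  have : 1 <= X E.
    rewrite /X (bigD1 S) //= iS lerDl; exact: sumr_ge0.
  by have : 0 <= (((n <= chromatic_number E * s)%N &&
      (chromatic_number E * k <= m * k + n)%N)%:R : R) by []; lra.
have := chromatic_number_ge Is; rewrite card_ord => -> /=.
case: (boolP [forall W : {set 'I_n}, (m <= #|W|)%N ==>
     (indep_ksubsets E W k != set0)]) => [/forallP H|].
  have := @chromatic_number_le _ E m k; rewrite card_ord => ->; first by rewrite mulr1n; lra.
  by move=> W mW; have := H W; rewrite mW.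
rewrite negb_forall => /existsP[W]; rewrite negb_imply negbK => /andP[mW IW].
have : 1 <= Z E by rewrite /Z (bigD1 W) //= IW lerDl; exact: sumr_ge0.
by have : 0 <= ((chromatic_number E * k <= m * k + n)%N%:R : R) by []; lra.
Qed.

End GnpUnionBound.

(** * Explicit estimates for fixed [n] when [1 - p] is written as [N ^ (- d)] *)

Section OneGraph.
Variable R : realType.

Lemma gt0_powRD (x r s : R) : 0 < x -> x `^ (r + s) = x `^ r * x `^ s.
Proof. by move=> x0; rewrite powRD // (gt_eqF x0) implybT. Qed.

Lemma natr_bin2 (j : nat) : 'C(j, 2)%:R = j%:R * (j%:R - 1) / 2 :> R.
Proof.
case: j => [|j]; first by rewrite mul0r mul0r.
have := mul_bin_diag j.+1 1; rewrite bin1 /= => /(congr1 (fun i => i%:R : R)).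
by rewrite !natrM => H; rewrite -natr1 addrK natr1 H mulrAC divff ?mul1r // pnatr_eq0.
Qed.

Lemma powR_bin2 (x d : R) (j : nat) : 0 < x ->
  (x `^ (- d)) ^+ 'C(j, 2) = x `^ (- d * (j%:R * (j%:R - 1) / 2)).
Proof. by move=> x0; rewrite -powR_mulrn ?powR_ge0 // -powRrM natr_bin2. Qed.

(* For x >= 4 / h the gap between [(k - 1) * d / 2] and 1 gives the bound; for
   x < 4 / h the quadratic term is negligible since d is of order h ^+ 2. *)
Lemma overlap_exponent (d h x k : R) : 0 < d -> 0 < h -> h <= 1 / 8 ->
  2 <= x -> x <= k -> (k - 1) * d <= 2 * (1 - h) -> d <= h ^+ 2 / 20 ->
  (- 1 + h * (7 / 20)) * x + d * (x * (x - 1) / 2) <= - 2 + h.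
Proof.
move=> d0 h0 h8 x2 xk kd dh.
have -> : (- 1 + h * (7 / 20)) * x + d * (x * (x - 1) / 2) =
  x * (- 1 + h * (7 / 20) + d * (x - 1) / 2) by field.
have [xh|xh] := lerP 4 (h * x).
  (* Since [d * (x - 1) / 2 <= 1 - h]; multiplying by [x] and using [h * x >= 4] gives at most
     [- 13 / 5]. *)
  have : - 1 + h * (7 / 20) + d * (x - 1) / 2 <= - (13 / 20) * h by nra.
  move=> H; apply: (@le_trans _ _ (x * (- (13 / 20) * h))).
    by apply: ler_wpM2l => //; lra.
  by lra.
(* Here [h * x < 4], so the remaining factor [- 1 + h * (9 / 20)] is negative and [x >= 2]
   finishes. *)
have H : d * (x - 1) / 2 <= h / 10.
  have : d * x <= h ^+ 2 / 20 * x by apply: ler_wpM2r => //; lra.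
  by nra.
apply: (@le_trans _ _ (x * (- 1 + h * (9 / 20)))).
  by apply: ler_wpM2l; lra.
by nra.
Qed.

(** By [overlap_exponent] each term is at most [N ^ (- 2 + h)], and there are at most
    [k <= N ^ (h / 20)] terms; [h <= 1 / 8] leaves room below [- 7 / 4]. *)
Lemma overlap_sum (N d h w : R) (k : nat) :
  1 <= N -> 0 < d -> 0 < h -> h <= 1 / 8 ->
  k%:R - 1 <= 2 * (1 - h) / d -> d <= h ^+ 2 / 20 ->
  k%:R <= N `^ (h / 20) -> N `^ (1 - h / 4) <= w ->
  \sum_(2 <= j < k.+1) ((k%:R ^+ 2 / w) ^+ j / (N `^ (- d)) ^+ 'C(j, 2))
    <= N `^ (- (7 / 4)).
Proof.
move=> N1 d0 h0 h8 kd dh kN wN; have N0 : 0 < N by lra.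
have w0 : 0 < w by apply: lt_le_trans wN; exact: powR_gt0.
have base : k%:R ^+ 2 / w <= N `^ (- 1 + h * (7 / 20)).
  have -> : - 1 + h * (7 / 20) = (h / 20 + h / 20) + - (1 - h / 4) by field.
  rewrite gt0_powRD // powRN; apply: ler_pM.
  - exact: sqr_ge0.
  - by rewrite invr_ge0 ltW.
  - by rewrite gt0_powRD // expr2; apply: ler_pM.
  - by rewrite lef_pV2 // posrE powR_gt0.
have term j : (2 <= j < k.+1)%N ->
    (k%:R ^+ 2 / w) ^+ j / (N `^ (- d)) ^+ 'C(j, 2) <= N `^ (- 2 + h).
  rewrite ltnS => /andP[j2 jk].
  rewrite powR_bin2 // -powRN.
  apply: (@le_trans _ _ ((N `^ (- 1 + h * (7 / 20))) ^+ j *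
     N `^ (- (- d * (j%:R * (j%:R - 1) / 2))))).
    apply: ler_wpM2r; first exact: powR_ge0.
    by apply: lerXn2r => //; rewrite nnegrE ?powR_ge0 // divr_ge0 ?sqr_ge0 // ltW.
  rewrite -powR_mulrn ?powR_ge0 // -powRrM -gt0_powRD //.
  apply: ler_powR => //; rewrite mulNr opprK.
  apply: (@overlap_exponent _ _ _ k%:R) => //; rewrite ?ler_nat //.
  by rewrite -ler_pdivlMr.
rewrite big_nat_cond.
apply: (@le_trans _ _ (\sum_(2 <= j < k.+1 | (2 <= j < k.+1)%N && true)
   N `^ (- 2 + h))).
  by apply: ler_sum => j; rewrite andbT; exact: term.
rewrite -big_nat_cond sumr_const_nat -[_ *+ _]mulr_natl.
apply: (@le_trans _ _ (N `^ (h / 20) * N `^ (- 2 + h))).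
  apply: ler_wpM2r; first exact: powR_ge0.
  by apply: le_trans kN; rewrite ler_nat; lia.
rewrite -gt0_powRD //; apply: ler_powR => //; lra.
Qed.

Lemma prob_no_indep_le (n m k : nat) (p d h : R) :
  let N : R := n%:R in
  0 <= p < 1 -> 1 - p = N `^ (- d) ->
  1 <= N -> 0 < d -> 0 < h -> h <= 1 / 8 -> (1 < k)%N ->
  k%:R - 1 <= 2 * (1 - h) / d -> d <= h ^+ 2 / 20 ->
  k%:R <= N `^ (h / 20) -> N `^ (1 - h / 4) <= m%:R ->
  forall W : {set 'I_n}, (m <= #|W|)%N ->
  bernoulli_mean p (vpairs 'I_n)
    (fun E => (indep_ksubsets E W k == set0)%:R) <= expR (- (N * N `^ (1 / 2) / 8)).
Proof.
move=> N p01 qN N1 d0 h0 h8 k1 kd dh kN mN W mW.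
have N0 : 0 < N by lra.
have wN : N `^ (1 - h / 4) <= #|W|%:R.
  by apply: le_trans mN _; rewrite ler_nat.
have kW : (k <= #|W|)%N.
  rewrite -(ler_nat R); apply: le_trans kN (le_trans _ wN).
  by apply: ler_powR => //; lra.
have sums := overlap_sum N1 d0 h0 h8 kd dh kN wN.
rewrite -qN in sums.
(* This [l] minimises [- l N^(7/4) + 2 l^2 N^2], with minimum [- N^(3/2) / 8]. *)
pose l := N `^ (- (1 / 4)) / 4.
have l01 : 0 <= l <= 1 / 2.
  rewrite /l divr_ge0 ?powR_ge0 //=.
  have : N `^ (- (1 / 4)) <= N `^ 0 by apply: ler_powR => //; lra.
  by rewrite powRr0; lra.
apply: le_trans (prob_no_indep_ksubset p01 (powR_gt0 _ N0) k1 kW l01 sums) _.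
rewrite ler_expR card_ord.
have e1 : l / N `^ (- (7 / 4)) = N * N `^ (1 / 2) / 4.
  rewrite /l -powRN opprK mulrAC -gt0_powRD // -[X in _ = X * _ / _]powRr1 ?ltW //.
  by rewrite -gt0_powRD //; congr (N `^ _ / _); field.
have e2 : l ^+ 2 * N ^+ 2 = N * N `^ (1 / 2) / 16.
  rewrite /l expr_div_n -[N ^+ 2]powR_mulrn ?ltW // expr2 -gt0_powRD //.
  rewrite mulrAC -gt0_powRD // -[X in _ = X * _ / _]powRr1 ?ltW //.
  rewrite -gt0_powRD //.
  have -> : - (1 / 4) + - (1 / 4) + 2%:R = 1 + 1 / 2 :> R by field.
  by rewrite expr2 -natrM.
have C2 : 'C(n, 2)%:R <= N ^+ 2.
  by rewrite -natrX ler_nat leq_bin_expn.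
have : l ^+ 2 * 'C(n, 2)%:R <= l ^+ 2 * N ^+ 2 by apply: ler_wpM2l; rewrite ?sqr_ge0.
rewrite e1 e2 -mulrA; lra.
Qed.

(** As [2 ^+ n <= expR N] and the other exponent is at most [- 2 N], the product is at most
    [expR (- N)], hence at most [1 / N]. *)
Lemma union_bound_le (n : nat) : let N : R := n%:R in
  1 <= N -> 16 <= N `^ (1 / 2) ->
  2 ^+ n * expR (- (N * N `^ (1 / 2) / 8)) <= N `^ (- 1).
Proof.
move=> N N1 N16; have N0 : 0 < N by lra.
have e2 : 2 <= expR 1 :> R by have := expR_ge1Dx (1 : R); lra.
have : 2 ^+ n <= expR N.
  rewrite /N -[n%:R]mulr1 expRM_natl.
  by apply: lerXn2r => //; rewrite nnegrE ?expR_ge0.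
move=> H; apply: (@le_trans _ _ (expR N * expR (- (N * N `^ (1 / 2) / 8)))).
  by apply: ler_wpM2r => //; exact: expR_ge0.
rewrite -expRD powRN powRr1 ?(ltW N0) //.
apply: (@le_trans _ _ (expR (- N))).
  by rewrite ler_expR; nra.
rewrite expRN lef_pV2 ?posrE ?expR_gt0 //.
by have := expR_ge1Dx N; lra.
Qed.

(** The exponent of [N] is at most [(s + 1) (1 - s d / 2)], and [s d / 2 >= 1 + h]. *)
Lemma first_moment_le (n s : nat) (d h : R) : let N : R := n%:R in
  1 <= N -> 0 < d -> 0 < h -> 2 * (1 + h) / d <= s%:R ->
  'C(n, s.+1)%:R * (N `^ (- d)) ^+ 'C(s.+1, 2) <= N `^ (- h).
Proof.
move=> N N1 d0 h0 sd; have N0 : 0 < N by lra.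
have {}sd : 2 * (1 + h) <= s%:R * d by rewrite -ler_pdivrMr.
rewrite powR_bin2 //.
apply: (@le_trans _ _ (N `^ s.+1%:R * N `^ (- d * (s.+1%:R * (s.+1%:R - 1) / 2)))).
  apply: ler_wpM2r; first exact: powR_ge0.
  by rewrite powR_mulrn ?(ltW N0) // -natrX ler_nat leq_bin_expn.
rewrite -gt0_powRD //; apply: ler_powR => //; rewrite -natr1 addrK.
have s0 : 0 <= s%:R :> R by [].
set x := s%:R in sd s0 *.
have -> : x + 1 + - d * ((x + 1) * x / 2) = (x + 1) * (1 - x * d / 2) by field.
nra.
Qed.

End OneGraph.

(** * Choice of the parameters and comparison with the predicted value *)

Section Asymptotics.
Variable R : realType.

(** The numerator is exactly [N * d * ln N], and [ln (p * N)] lies between [(1 - h) * ln N] and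
    [ln N] because [ln p >= - 2]. *)
Lemma predicted_chromatic_bounds (N p d h : R) : 0 < h -> h <= 1 / 8 ->
  1 / 2 <= p -> p < 1 -> 1 < N -> 1 - p = N `^ (- d) ->
  1 <= d * ln N -> d <= h ^+ 2 / 20 ->
  N * d / 2 <= N * ln (1 / (1 - p)) / (2 * ln (p * N)) <=
  N * d / (2 * (1 - h)).
Proof.
move=> h0 h8 p2 p1 N1 qN dL dh; have N0 : 0 < N by lra.
have p0 : 0 < p by lra.
have L0 : 0 < ln N by exact: ln_gt0.
have d0 : 0 < d by rewrite -(pmulr_lgt0 _ L0); lra.
have -> : ln (1 / (1 - p)) = d * ln N.
  by rewrite qN powRN div1r invrK ln_powR.
have lnp : ln p <= 0 by apply: ln_le0; lra.
have lnp2 : - 2 <= ln p.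
  have := ln_sublinear (_ : 0 < p^-1); rewrite invr_gt0 => /(_ p0).
  rewrite lnV ?posrE //; have : p^-1 <= 2; last by lra.
  by rewrite -[leRHS]invrK lef_pV2 ?posrE ?invr_gt0 //; lra.
(* The two bounds on [d] force [h^2 ln N >= 20]. *)
have hL : 2 <= h * ln N.
  have H : 1 <= h ^+ 2 / 20 * ln N.
    by apply: le_trans dL _; apply: ler_wpM2r => //; exact: ltW.
  have : h * (h * ln N) <= 1 / 8 * (h * ln N).
    by apply: ler_wpM2r => //; rewrite mulr_ge0 // ltW.
  by lra.
rewrite lnM ?posrE //; set P := ln p + ln N.
have PL : P <= ln N by rewrite /P; lra.
have PL2 : (1 - h) * ln N <= P by rewrite /P; lra.
have P0 : 0 < P by apply: lt_le_trans PL2; apply: mulr_gt0 => //; lra.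
apply/andP; split.
  rewrite ler_pdivlMr ?mulr_gt0 //.
  have -> : N * d / 2 * (2 * P) = N * (d * P) by field.
  by do 2 (apply: ler_wpM2l; first exact: ltW).
have h1 : 0 < 1 - h by lra.
rewrite ler_pdivrMr ?mulr_gt0 //.
have -> : N * d / (2 * (1 - h)) * (2 * P) = N * (d * (P / (1 - h))).
  by field; rewrite gt_eqF.
do 2 (apply: ler_wpM2l; first exact: ltW).
by rewrite ler_pdivlMr // mulrC.
Qed.

Lemma ln_le_powR (N a : R) : 0 < N -> a * ln N <= N `^ a.
Proof. by move=> N0; rewrite -ln_powR; apply/ltW/ln_sublinear/powR_gt0. Qed.

(** Take for [k] the least integer above [2 * (1 - h) / d]. Since [1 / d <= ln N], it is at most
    [3 * ln N], and [120 = 3 * 40] comes from [ln_le_powR] at [h / 40]. *)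
Lemma exists_indep_size (N d h : R) : 0 < h -> h <= 1 / 8 -> 1 < N ->
  0 < d -> d <= 1 -> 1 <= d * ln N -> 120 <= h * N `^ (h / 40) ->
  exists k : nat, [/\ (1 < k)%N, k%:R - 1 <= 2 * (1 - h) / d,
    2 * (1 - h) / d <= k%:R & k%:R <= N `^ (h / 20)].
Proof.
move=> h0 h8 N1 d0 d1 dL Nh; have N0 : 0 < N by lra.
pose x := 2 * (1 - h) / d; have x1 : 1 <= x by rewrite /x ler_pdivlMr //; lra.
have /andP[kx xk] : (Num.truncn x)%:R <= x < (Num.truncn x).+1%:R.
  by apply: truncn_itv; lra.
exists (Num.truncn x).+1; split.
- by rewrite ltnS truncn_gt0.
- by rewrite -natr1 addrK.
- exact: ltW.
have dV : d^-1 <= ln N by rewrite -[d^-1]mul1r ler_pdivrMr // mulrC.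
have dV1 : 1 <= d^-1 by rewrite invf_ge1.
have xd : x <= 2 * d^-1 by apply: ler_wpM2r; lra.
apply: (@le_trans _ _ (3 * ln N)); first by rewrite -natr1; lra.
have -> : h / 20 = h / 40 + h / 40 by field.
have := ln_le_powR (h / 40) N0; rewrite gt0_powRD //.
have := powR_ge0 N (h / 40); set A := N `^ (h / 40) in Nh * => A0 H.
rewrite -(ler_pM2l h0); apply: (@le_trans _ _ (120 * A)); first by lra.
by rewrite mulrA; apply: ler_wpM2r.
Qed.

(** Rounding up costs at most a factor 2, so [2 * ln N <= h * N ^ (h / 4)] is enough, again because
    [1 / d <= ln N]. Colouring these [m] leftover vertices individually costs only a fraction of
    order [h] of the predicted value. *)
Lemma exists_leftover_size (N d h : R) : 0 < h -> h <= 1 / 8 -> 1 < N ->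
  0 < d -> 1 <= d * ln N -> 80 <= h ^+ 2 * N `^ (h / 40) ->
  exists m : nat, N `^ (1 - h / 4) <= m%:R <= h * (N * d).
Proof.
move=> h0 h8 N1 d0 dL Nh; have N0 : 0 < N by lra.
have N1' : 1 <= N by lra.
pose y := N `^ (1 - h / 4); rewrite -/y.
have y1 : 1 <= y by rewrite /y -[leLHS](powRr0 N); apply: ler_powR => //; lra.
have y0 : 0 <= y by lra.
have /andP[my ym] := truncn_itv y0.
exists (Num.truncn y).+1; rewrite (ltW ym) -natr1 /=.
apply: (@le_trans _ _ (2 * y)); first by lra.
have NE : N = y * N `^ (h / 4) by rewrite /y -gt0_powRD // subrK powRr1 // ltW.
rewrite [X in _ <= _ * (X * _)]NE.
have -> : h * (y * N `^ (h / 4) * d) = y * (h * d * N `^ (h / 4)) by ring.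
rewrite mulrC; apply: ler_wpM2l => //.
have L0 : 0 < ln N by exact: ln_gt0.
rewrite -(ler_pM2r L0).
have -> : h * d * N `^ (h / 4) * ln N = (d * ln N) * (h * N `^ (h / 4)) by ring.
apply: (@le_trans _ _ (1 * (h * N `^ (h / 4)))); last first.
  by apply: ler_wpM2r => //; rewrite mulr_ge0 ?powR_ge0 // ltW.
rewrite mul1r.
apply: (@le_trans _ _ (h * (N `^ (h / 40) * N `^ (h / 40)))); last first.
  apply: ler_wpM2l; first exact: ltW.
  by rewrite -gt0_powRD //; apply: ler_powR => //; lra.
have := ln_le_powR (h / 40) N0.
have := powR_ge0 N (h / 40); set A := N `^ (h / 40) in Nh * => A0 H.
rewrite -(ler_pM2l h0); apply: (@le_trans _ _ (80 * A)); first by lra.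
have -> : h * (h * (A * A)) = (h ^+ 2 * A) * A by ring.
exact: ler_wpM2r.
Qed.

(** Below, [c >= N / s >= N d / (2 + 4 h)]. Above, [m] contributes [h N d] and [N / k] at most
    [N d (1 + 2 h) / 2], which add up to exactly [(1 + 4 h) N d / 2]. *)
Lemma chromatic_sandwich (N d eps Y c k m s : R) : let h := eps / 4 in
  0 < eps -> eps <= 1 / 2 -> 0 < N -> 0 < d -> d <= eps / 2 ->
  N * d / 2 <= Y <= N * d / (2 * (1 - h)) ->
  0 <= c -> 0 < k -> 2 * (1 - h) / d <= k -> m <= h * (N * d) ->
  s <= 2 * (1 + h) / d + 1 -> N <= c * s -> c * k <= m * k + N ->
  (1 - eps) * Y <= c <= (1 + eps) * Y.
Proof.
move=> h e0 e2 N0 d0 de /andP[Ylo Yhi] c0 k0 kd mN sd Ns ck.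
have h0 : 0 < h by rewrite /h; lra.
have h8 : h <= 1 / 8 by rewrite /h; lra.
have h1 : 0 < 1 - h by lra.
have eh : eps = 4 * h by rewrite /h; field.
rewrite {}eh in e0 e2 de *; move: (h) h0 h8 h1 Ylo Yhi kd mN sd e0 e2 de => {}h.
move=> h0 h8 h1 Ylo Yhi kd mN sd e0 e2 de.
apply/andP; split.
  apply: (@le_trans _ _ ((1 - 4 * h) * (N * d / (2 * (1 - h))))).
    by apply: ler_wpM2l => //; lra.
  (* The rounding term 1 in the bound on [s] costs [d], which is at most [2 * h]. *)
  have {}sd : s * d <= 2 + 4 * h.
    apply: (@le_trans _ _ ((2 * (1 + h) / d + 1) * d)).
      by apply: ler_wpM2r => //; exact: ltW.
    by rewrite mulrDl divfK ?gt_eqF //; lra.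
  have H : N * d <= c * (2 + 4 * h).
    apply: (@le_trans _ _ (c * s * d)); first by apply: ler_wpM2r => //; exact: ltW.
    by rewrite -mulrA; apply: ler_wpM2l.
  rewrite mulrA ler_pdivrMr ?mulr_gt0 //.
  apply: (@le_trans _ _ ((1 - 4 * h) * (c * (2 + 4 * h)))).
    by apply: ler_wpM2l => //; lra.
  by rewrite mulrCA; apply: ler_wpM2l => //; nra.
apply: (@le_trans _ _ ((1 + 4 * h) * (N * d / 2))); last first.
  by apply: ler_wpM2l => //; lra.
have {}kd : 2 * (1 - h) <= k * d by rewrite -ler_pdivrMr.
have {}ck : c <= m + N / k.
  by rewrite -(ler_pM2r k0) mulrDl divfK // gt_eqF.
have Nk : N / k <= N * d * ((1 + 2 * h) / 2).
  rewrite ler_pdivrMr // [leRHS](_ : _ = (k * d) * ((1 + 2 * h) / 2) * N); last first.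
    by field.
  rewrite -[leLHS]mul1r; apply: ler_wpM2r; first exact: ltW.
  apply: (@le_trans _ _ (2 * (1 - h) * ((1 + 2 * h) / 2))); first by nra.
  by apply: ler_wpM2r => //; lra.
by apply: le_trans ck _; apply: le_trans (lerD mN Nk) _; lra.
Qed.

(** A version without limits: what remains for the theorem is that these inequalities hold for all
    large [n]. *)
Lemma gnp_chromatic_concentration (n : nat) (p d eps : R) :
  let N : R := n%:R in let h := eps / 4 in
  let Y := N * ln (1 / (1 - p)) / (2 * ln (p * N)) in
  0 < eps -> eps <= 1 / 2 -> 1 / 2 <= p -> p < 1 -> 1 < N ->
  1 - p = N `^ (- d) -> 1 <= d * ln N -> d <= h ^+ 2 / 20 ->
  120 / h ^+ 2 <= N `^ (h / 40) ->
  1 - (N `^ (- h) + N `^ (- 1)) <=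
  gnp_prob p (fun G : {set {set 'I_n}} =>
    (1 - eps) * Y <= (chromatic_number G)%:R <= (1 + eps) * Y).
Proof.
move=> N h Y e0 e2 p2 p1 N1 qN dL dh Nbig.
have h0 : 0 < h by rewrite /h; lra.
have h8 : h <= 1 / 8 by rewrite /h; lra.
have N0 : 0 < N by lra.
have N1' : 1 <= N by lra.
have d0 : 0 < d by rewrite -(pmulr_lgt0 _ (ln_gt0 N1)); lra.
have p01 : 0 <= p < 1 by apply/andP; split => //; lra.
have dh' : d <= h / 160 by nra.
have Yb : N * d / 2 <= Y <= N * d / (2 * (1 - h)).
  exact: predicted_chromatic_bounds.
have A0 := powR_ge0 N (h / 40).
have Nh : 120 <= h ^+ 2 * N `^ (h / 40).
  by rewrite -ler_pdivrMl ?exprn_gt0 // mulrC.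
have Nh1 : 120 <= h * N `^ (h / 40).
  by apply: le_trans Nh _; apply: ler_wpM2r => //; nra.
have N16 : 16 <= N `^ (1 / 2).
  apply: (@le_trans _ _ (N `^ (h / 40))); last by apply: ler_powR => //; lra.
  by nra.
have d1 : d <= 1 by lra.
have [k [k1 kd dk kN]] := exists_indep_size h0 h8 N1 d0 d1 dL Nh1.
have Nh80 : 80 <= h ^+ 2 * N `^ (h / 40) by apply: le_trans Nh; lra.
have [m /andP[mN Nm]] := exists_leftover_size h0 h8 N1 d0 dL Nh80.
pose z := 2 * (1 + h) / d.
have z0 : 0 <= z by rewrite /z divr_ge0 ?(ltW d0) //; lra.
have /andP[sz zs] := truncn_itv z0.
have Wb := prob_no_indep_le p01 qN N1' d0 h0 h8 k1 kd dh kN mN.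
have lo := gnp_chromatic_bounds p01 (Num.truncn z).+1 (expR_ge0 _) Wb.
apply: le_trans (le_trans lo (gnp_prob_sub p01 _)).
  rewrite lerD2l lerN2; apply: lerD; last exact: union_bound_le.
  by rewrite qN; apply: first_moment_le => //; exact: ltW.
move=> G /andP[ns ck].
apply: (@chromatic_sandwich N d _ _ _ k%:R m%:R (Num.truncn z).+1%:R) => //.
- by rewrite /h in dh'; lra.
- by rewrite ltr0n ltnW.
- by rewrite -natr1 lerD2r.
- by rewrite -natrM ler_nat.
- by rewrite -!natrM -natrD ler_nat.
Qed.

End Asymptotics.

(** * Passage to the limit *)

Lemma near_powR_ge (R : realType) (a M : R) : 0 < a ->
  (\forall n \near \oo, M <= (n%:R : R) `^ a)%classic.
Proof.
move=> a0; near=> n.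
have M0 : 0 <= Num.max M 0 by rewrite le_max lexx orbT.
have : Num.max M 0 `^ a^-1 <= n%:R by near: n; exact: nbhs_infty_ger.
move=> /(ge0_ler_powR (ltW a0)); rewrite !nnegrE powR_ge0 => /(_ isT (ler0n _ _)).
rewrite -powRrM mulVf ?gt_eqF // powRr1 //; apply: le_trans.
by rewrite le_max lexx.
Unshelve. all: by end_near.
Qed.

Local Open Scope classical_set_scope.
Local Open Scope ring_scope.

Theorem theorem1p1 (R : realType) (p : nat -> R)
  (p_ge0_lt1 : forall n : nat, 0 <= p n < 1)
  (p_to_1 : p n @[n --> \oo] --> (1 : R))
  (q_n_o1 : is_n_pow_o1 (fun n : nat => 1 - p n)) :
  let Y : nat -> R := fun n : nat =>
    (n%:R * ln (1 / (1 - p n))) / (2 * ln (p n * n%:R)) in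
  forall eps : R, 0 < eps ->
    gnp_whp p (fun (n : nat) (G : {set {set 'I_n}}) =>
      (1 - eps) * Y n <= (chromatic_number G)%:R <= (1 + eps) * Y n).
Proof.
move=> Y eps eps0; case: q_n_o1 => e e_to_0 qe.
(* The concentration lemma needs a tolerance of at most [1 / 2]; a smaller tolerance gives a
   stronger conclusion. *)
pose e' := Num.min eps (1 / 2).
have e'0 : 0 < e' by rewrite lt_min eps0 /=; lra.
have e'2 : e' <= 1 / 2 by rewrite ge_min lexx orbT.
have e'eps : e' <= eps by rewrite ge_min lexx.
pose h := e' / 4; have h0 : 0 < h by rewrite /h; lra.
have p_near (x : R) : 0 < x -> (\forall n \near \oo, 1 - p n <= x)%classic.
  move=> x0; have /cvgrPdist_le /(_ x x0) := p_to_1.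
  apply: filterS => i; exact: le_trans (ler_norm _).
have e_near : (\forall n \near \oo, `|0 - e n| <= h ^+ 2 / 20)%classic.
  by move/cvgrPdist_le: e_to_0; apply; rewrite divr_gt0 ?exprn_gt0.
apply/cvgrPdist_le => t t0; near=> n.
have P1 := gnp_prob_le1 (p_ge0_lt1 n) (fun G : {set {set 'I_n}} =>
  (1 - eps) * Y n <= (chromatic_number G)%:R <= (1 + eps) * Y n).
rewrite ger0_norm ?subr_ge0 // lerBlDl -lerBlDr.
have /andP[p0 p1] := p_ge0_lt1 n.
have N2 : 2 <= n%:R :> R by near: n; exact: nbhs_infty_ger.
have Nt : n%:R `^ (- h) + n%:R `^ (- 1) <= t.
  have inv_le (x : R) : 2 / t <= x -> x^-1 <= t / 2.
    move=> tx; rewrite -[leRHS]invrK lef_pV2 ?posrE ?invr_gt0 ?divr_gt0 //.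
      by rewrite invf_div.
    by apply: lt_le_trans tx; rewrite divr_gt0.
  have : n%:R `^ (- h) <= t / 2.
    by rewrite powRN; apply: inv_le; near: n; exact: near_powR_ge.
  have : n%:R `^ (- 1) <= t / 2.
    by rewrite powRN; apply: inv_le; near: n; exact: near_powR_ge.
  by lra.
have p2 : 1 / 2 <= p n.
  have : 1 - p n <= 1 / 2; last by lra.
  by near: n; apply: p_near; lra.
have qn : 1 - p n = n%:R `^ (- - e n) by rewrite opprK; near: n.
have N0 : 0 < n%:R :> R by lra.
(* With [d = - e n], this says that [1 - p n <= expR (- 1)], which holds eventually because [p]
   tends to 1. *)
have dL : 1 <= - e n * ln n%:R.
  have : 1 - p n <= expR (- 1) by near: n; apply: p_near; exact: expR_gt0.
  rewrite qn opprK /powR gt_eqF // ler_expR; lra.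
have dh : - e n <= h ^+ 2 / 20.
  have : `|0 - e n| <= h ^+ 2 / 20 by near: n; exact: e_near.
  by rewrite sub0r; apply: le_trans (ler_norm _).
have Nbig : 120 / h ^+ 2 <= n%:R `^ (h / 40).
  by near: n; apply: near_powR_ge; rewrite divr_gt0.
have N1 : 1 < n%:R :> R by lra.
have := gnp_chromatic_concentration e'0 e'2 p2 p1 N1 qn dL dh Nbig.
rewrite -/h => H.
apply: le_trans (_ : _ <= 1 - (n%:R `^ (- h) + n%:R `^ (- 1))) _; first by lra.
apply: le_trans H (gnp_prob_sub (p_ge0_lt1 n) _) => G /andP[lo hi].
rewrite -/(Y n) in lo hi.
(* The two bounds together give [(1 - e') Y <= (1 + e') Y], so [Y] is nonnegative and the interval
   may be widened from [e'] to [eps]. *)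
have Y0 : 0 <= Y n by rewrite -(pmulr_rge0 _ e'0); lra.
have eY := ler_wpM2r Y0 e'eps.
by apply/andP; split; lra.
Unshelve. all: by end_near.
Qed.
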